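(* Let $F$ be a field, and let $F(x)$ be the field of rational functions in $x$ over $F$. Let $G$ be any finite subgroup of $PGL(2,F)$. Assume that $G$ is not a subgroup of $PGL(2,K)$ for any proper subfield $K$ of $F$. Let $f(x)/g(x)$, with $f,g\in F[x]$ relatively prime and one of $f,g$ monic, be a nonconstant coefficient of the orbit polynomial $P_G(T)$ of $G$. Let $H$ be a nontrivial finite group of automorphisms of $F$, with fixed field $E$, and suppose that $H$ fixes $G$ (so that $f$ and $g$ have coefficients in $E$). Let $L$ be the splitting field of $f(T)-xg(T)$ over $E(x)$, which is also its splitting field over $F(x)$, and let $\Gamma=\mathrm{Gal}(L/E(x))$. Then $\Gamma$ is a split extension of $G$; that is, the normal subgroup $\mathrm{Gal}(L/F(x))\cong G$ of $\Gamma$ has a complement in $\Gamma$.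
   Context: Elements of $PGL(2,F)$ are written as linear fractional transformations $s(x)=\frac{ax+b}{cx+d}$ with $a,b,c,d\in F$, $ad-bc\neq0$. The orbit polynomial of $G$ is $P_G(T)=\prod_{s\in G}(T-s(x))\in F(x)[T]$; a coefficient is nonconstant if it is not in $F$. ''$G$ is defined over the subfield $K$ of $F$'' means: for each $s\in G$, $s(x)=(ax+b)/(cx+d)$, there is a nonzero $e\in\{a,b,c,d\}$ such that $a/e,b/e,c/e,d/e$ all lie in $K$. ''$G$ is not a subgroup of $PGL(2,K)$ for any proper subfield $K$ of $F$'' means that $G$ is not defined over any proper subfield $K$ of $F$. For $\sigma\in H$ and $s(x)=\frac{ax+b}{cx+d}$ in $PGL(2,F)$, put $\sigma.s(x)=\frac{\sigma(a)x+\sigma(b)}{\sigma(c)x+\sigma(d)}$, and $\sigma.G=\{\sigma.s: s\in G\}$. ''$H$ fixes $G$'' means $\sigma.G=G$ for all $\sigma\in H$. Under these hypotheses it is known that the splitting fields of $f(T)-xg(T)$ over $E(x)$ and over $F(x)$ coincide and that $\mathrm{Gal}(L/F(x))\cong G$. *)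

(* Defs.v *)
From HB Require Import structures.
From mathcomp Require Import all_boot all_order all_fingroup all_algebra.
From mathcomp Require Import all_solvable all_field finmap.
(* Imported last: [repr] is that of quotients, not that of group sets. *)
From mathcomp Require Import generic_quotient.

Set Implicit Arguments.
Unset Strict Implicit.
Unset Printing Implicit Defensive.

Import GRing.Theory.
Local Open Scope ring_scope.
Local Open Scope quotient_scope.

Notation "x %:F" := (@FracField.tofrac _ x) : ring_scope.

(* F(x), with the indeterminate x being ('X)%:F. *)
Notation ratfun F := {fraction {poly F}}.

(* PGL(2, F) is the quotient of GL(2, F) by the nonzero scalar matrices. *)

Section GL2.
Variable F : fieldType.

Record GL2 := MkGL2 { gl2 :> 'M[F]_2 ; gl2_unit : gl2 \in unitmx }.

HB.instance Definition _ := [isSub for gl2].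
HB.instance Definition _ := [Choice of GL2 by <:].

Definition gl2_one := MkGL2 (unitmx1 F 2).

Fact gl2_mul_subproof (A B : GL2) : A *m B \in unitmx.
Proof. by rewrite unitmx_mul !gl2_unit. Qed.
Definition gl2_mul A B := MkGL2 (gl2_mul_subproof A B).

Fact gl2_inv_subproof (A : GL2) : invmx A \in unitmx.
Proof. by rewrite unitmx_inv gl2_unit. Qed.
Definition gl2_inv A := MkGL2 (gl2_inv_subproof A).

Definition proj_eq (A B : GL2) := is_scalar_mx (invmx A *m B).

Lemma proj_eqP (A B : GL2) :
  reflect (exists2 e : F, e != 0 & gl2 B = e *: gl2 A) (proj_eq A B).
Proof.
apply: (iffP is_scalar_mxP) => [[e De]|[e _ ->]]; last first.
  by exists e; rewrite -scalemxAr mulVmx ?gl2_unit // scalemx1.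
have DB: gl2 B = e *: gl2 A.
  by rewrite -(mulKVmx (gl2_unit A) B) De mul_mx_scalar.
exists e => //; apply/eqP => e0; have := gl2_unit B.
by rewrite DB e0 scale0r unitmxE det0 unitr0.
Qed.

Fact proj_eq_refl : reflexive proj_eq.
Proof. by move=> A; apply/proj_eqP; exists 1; rewrite ?oner_neq0 ?scale1r. Qed.

Fact proj_eq_sym : symmetric proj_eq.
Proof.
move=> A B; apply/proj_eqP/proj_eqP => -[e e0 ->];
  by exists e^-1; rewrite ?invr_eq0 // scalerA mulVf // scale1r.
Qed.

Fact proj_eq_trans : transitive proj_eq.
Proof.
move=> B A C /proj_eqP[e e0 DB] /proj_eqP[h h0 DC]; apply/proj_eqP.
by exists (h * e); rewrite ?mulf_neq0 // DC DB scalerA.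
Qed.

Canonical proj_eq_equiv := EquivRel proj_eq proj_eq_refl proj_eq_sym
  proj_eq_trans.

Definition PGL2 := {eq_quot proj_eq}.

HB.instance Definition _ : EqQuotient _ proj_eq PGL2 := EqQuotient.on PGL2.
HB.instance Definition _ := Choice.on PGL2.

Lemma pi_PGL2P (A B : GL2) :
  reflect (exists2 e : F, e != 0 & gl2 B = e *: gl2 A)
          (\pi_PGL2 A == \pi_PGL2 B).
Proof. by rewrite eqmodE; apply: proj_eqP. Qed.

Lemma repr_PGL2 (A : GL2) :
  exists2 e : F, e != 0 & gl2 (repr (\pi_PGL2 A)) = e *: gl2 A.
Proof. by apply/pi_PGL2P; rewrite reprK. Qed.

Definition PGL2_one : PGL2 := lift_cst PGL2 gl2_one.
Definition PGL2_mul := lift_op2 PGL2 gl2_mul.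
Definition PGL2_inv := lift_op1 PGL2 gl2_inv.
Canonical PGL2_one_morph := PiConst PGL2_one.

Lemma pi_PGL2_mul : {morph \pi_PGL2 : A B / gl2_mul A B >-> PGL2_mul A B}.
Proof.
move=> A B; unlock PGL2_mul; apply/eqP/pi_PGL2P => /=.
have [e e0 ->] := repr_PGL2 A; have [h h0 ->] := repr_PGL2 B.
by exists (h * e); rewrite ?mulf_neq0 // -scalemxAr -scalemxAl scalerA.
Qed.
Canonical PGL2_mul_morph := PiMorph2 pi_PGL2_mul.

Lemma pi_PGL2_inv : {morph \pi_PGL2 : A / gl2_inv A >-> PGL2_inv A}.
Proof.
move=> A; unlock PGL2_inv; apply/eqP/pi_PGL2P => /=.
have [e e0 ->] := repr_PGL2 A; exists e^-1; first by rewrite invr_eq0.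
by rewrite invmxZ // unitmxZ ?unitfE ?gl2_unit.
Qed.
Canonical PGL2_inv_morph := PiMorph1 pi_PGL2_inv.

Fact PGL2_mulA : associative PGL2_mul.
Proof.
elim/quotW=> A; elim/quotW=> B; elim/quotW=> C; rewrite !piE.
by congr \pi; apply: val_inj; rewrite /= mulmxA.
Qed.

Fact PGL2_mul1 : left_id PGL2_one PGL2_mul.
Proof.
by elim/quotW=> A; rewrite !piE; congr \pi; apply: val_inj; rewrite /= mul1mx.
Qed.

Fact PGL2_mulr1 : right_id PGL2_one PGL2_mul.
Proof.
by elim/quotW=> A; rewrite !piE; congr \pi; apply: val_inj; rewrite /= mulmx1.
Qed.

Fact PGL2_mulV : left_inverse PGL2_one PGL2_inv PGL2_mul.
Proof.
elim/quotW=> A; rewrite !piE; congr \pi; apply: val_inj.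
by rewrite /= mulVmx ?gl2_unit.
Qed.

Fact PGL2_mulrV : right_inverse PGL2_one PGL2_inv PGL2_mul.
Proof.
elim/quotW=> A; rewrite !piE; congr \pi; apply: val_inj.
by rewrite /= mulmxV ?gl2_unit.
Qed.

HB.instance Definition _ := isGroup.Build PGL2
  PGL2_mulA PGL2_mul1 PGL2_mulr1 PGL2_mulV PGL2_mulrV.

Definition gl2_lft (A : GL2) : ratfun F :=
  (A 0 0 *: 'X + (A 0 1)%:P)%:F / (A 1 0 *: 'X + (A 1 1)%:P)%:F.

Definition lft (s : PGL2) : ratfun F := gl2_lft (repr s).

Lemma lft_pi (A : GL2) : lft (\pi_PGL2 A) = gl2_lft A.
Proof.
rewrite /lft /gl2_lft; have [e e0 ->] := repr_PGL2 A; rewrite !mxE.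
have De a b : (e * a) *: 'X + (e * b)%:P = e%:P * (a *: 'X + b%:P) :> {poly F}.
  by rewrite mulrDr polyCM -!mul_polyC polyCM mulrA.
rewrite !De !tofracM -mulf_div divff ?mul1r //.
by rewrite tofrac_eq0 polyC_eq0.
Qed.

Definition orbit_poly (G : {fset PGL2}) : {poly ratfun F} :=
  \prod_(s <- G) ('X - (lft s)%:P).

(* By invariance under scaling, it does not matter which of the matrices A
   representing an element of G are considered. *)
Definition defined_over (K : {pred F}) (G : {fset PGL2}) : Prop :=
  forall A : GL2, \pi_PGL2 A \in G ->
  exists i j, A i j != 0 /\ forall k l, A k l / A i j \in K.

(* The polynomial f(T) - x g(T) of F(x)[T]. *)
Definition fiber_poly (f g : {poly F}) : {poly ratfun F} :=
  map_poly (fun c => c%:P%:F) f - ('X)%:F *: map_poly (fun c => c%:P%:F) g.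

End GL2.

Arguments lft {F} s.

Section Action.
Variables (F : fieldType) (sigma : {rmorphism F -> F}).

Fact gl2_map_subproof (A : GL2 F) : map_mx sigma A \in unitmx.
Proof. by rewrite map_unitmx gl2_unit. Qed.
Definition gl2_map A := MkGL2 (gl2_map_subproof A).

Definition PGL2_map := lift_op1 (PGL2 F) gl2_map.

Lemma pi_PGL2_map :
  {morph \pi_(PGL2 F) : A / gl2_map A >-> PGL2_map A}.
Proof.
move=> A; unlock PGL2_map; apply/eqP/pi_PGL2P => /=.
have [e e0 ->] := repr_PGL2 A; exists (sigma e); first by rewrite fmorph_eq0.
by rewrite map_mxZ.
Qed.
Canonical PGL2_map_morph := PiMorph1 pi_PGL2_map.

End Action.

(* A finite group of automorphisms of F, given as the image of a finite group
   acting faithfully on F by ring automorphisms (each H u is bijective, with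
   inverse H (u^-1)). *)
Definition faithful_aut (F : fieldType) (hT : finGroupType)
    (H : hT -> {rmorphism F -> F}) : Prop :=
  (forall u v : hT, H (u * v)%g =1 H u \o H v)
  /\ (forall u v : hT, H u =1 H v -> u = v).

Section FixedField.
Variables (F : fieldType) (hT : finGroupType) (H : hT -> {rmorphism F -> F}).

Definition fixed : {pred F} := [pred a | [forall u, H u a == a]].

Fact fixed_divring_closed : divring_closed fixed.
Proof.
split=> [|a b /forallP Ha /forallP Hb|a b /forallP Ha /forallP Hb];
  apply/forallP=> u.
- by rewrite rmorph1.
- by rewrite rmorphB (eqP (Ha u)) (eqP (Hb u)).
- by rewrite fmorph_div (eqP (Ha u)) (eqP (Hb u)).
Qed.

Record fixed_field := FixedField { ffval :> F ; _ : ffval \in fixed }.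

HB.instance Definition _ := [isSub for ffval].
HB.instance Definition _ := [Choice of fixed_field by <:].
HB.instance Definition _ :=
  GRing.SubChoice_isSubComUnitRing.Build F fixed fixed_field
    fixed_divring_closed.
HB.instance Definition _ :=
  [SubComUnitRing_isSubIntegralDomain of fixed_field by <:].
HB.instance Definition _ :=
  [SubIntegralDomain_isSubField of fixed_field by <:].

End FixedField.

(* [isog] does not apply here, as rT need not be finite. *)
Definition isog_fset (aT : finGroupType) (A : {set aT}) (rT : groupType)
    (G : {fset rT}) : Prop :=
  exists phi : aT -> rT,
    [/\ {in A &, {morph phi : u v / (u * v)%g}},
        {in A &, injective phi}
      & forall s, s \in G <-> exists2 u, u \in A & s = phi u].

(* Main.v *)
Require Import Defs.
From HB Require Import structures.
From mathcomp Require Import all_boot all_order all_fingroup all_algebra.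
From mathcomp Require Import all_solvable all_field finmap.
From mathcomp Require Import generic_quotient ring.

Set Implicit Arguments.
Unset Strict Implicit.
Unset Printing Implicit Defensive.

Import GRing.Theory.
Local Open Scope ring_scope.

(** Let [y] be a root of [f(T) - x g(T)] in [L]. Then [x = f(y)/g(y)], so
    [y] is transcendental over [F] and the substitution of [y] for the
    indeterminate is an embedding [i] of F(x) into [Omega], whose image [M]
    is Fx(y) ([fiber_root_embedding], [Fadjoin_image]). The automorphisms
    sought are constructed on the abstract field F(x) and then carried to
    [M] by [i] ([gal_transport]).  As [i] maps f/g to the element [x] of
    [Omega], it is f/g that they have to fix.

    Two families of endomorphisms of F(x) fix f/g, because they permute the
    roots of the orbit polynomial, of which f/g is a coefficient
    ([map_orbit_poly]): the substitutions of s(x) for the indeterminate,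
    with [s] in [G], and the actions of the elements of [H] on coefficients.

    The first family fixes the constants, and gives the |G| distinct roots
    s(y) of a polynomial whose degree is at most |G|
    ([orbit_poly_coef_size], [fiber_poly_factor]). So [M] is the splitting
    field over Fx of a separable polynomial, and the map taking [n] to the
    [s] such that n(y) = s(y) is an isomorphism from N = Gal(M/Fx) onto [G]
    ([isog_gal_orbit]).

    The second family gives a group [K] of automorphisms of [M] that fix [y]
    and preserve Fx, and the elements of Fx fixed by [K] are those of E(x)
    ([coef_fixed_base]). Since M = Fx(y), only the identity is in both [N]
    and [K], and by the Galois correspondence N K is all of Gal(M/E(x))
    ([Fadjoin_complement]).

    It remains to see that L = M, which is where [G] must not be defined
    over a proper subfield. An element of Gal(M/L) is a product of an
    element [n] of [N] and of the automorphism given by some [u] in [H]. It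
    fixes [y], so n = 1; it fixes every s(y), so [u] fixes every element of
    [G], and [G] is defined over the subfield of [F] fixed by [u]
    ([PGL2_map_faithful]). Hence u = 1, and L = M because M/L is a Galois
    extension with trivial group. *)

(** * Morphisms from a field of rational functions *)

Section RationalFunctions.
Variables (F A : fieldType).

Definition cst (c : F) : ratfun F := c%:P%:F.
HB.instance Definition _ :=
  GRing.RMorphism.copy cst (@FracField.tofrac _ \o polyC).
Definition indet : ratfun F := 'X%:F.

Lemma ratfun_repr (q : ratfun F) :
  q = (frac (repr q)).1%:F / (frac (repr q)).2%:F.
Proof.
have d0 := denom_ratioP (repr q).
apply: (canRL (mulfK _)); first by rewrite tofrac_eq0.
rewrite -{1}[q]reprK !piE; apply/eqP; rewrite equivf_def /FracField.mulf.
by rewrite !numden_Ratio ?mulr1 ?mul1r ?oner_neq0 // mulrC.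
Qed.

Lemma ratfun_frac (q : ratfun F) :
  exists a b : {poly F}, b != 0 /\ q = a%:F / b%:F.
Proof.
exists (frac (repr q)).1, (frac (repr q)).2.
by split; [exact: denom_ratioP | exact: ratfun_repr].
Qed.

Lemma tofrac_horner (p : {poly F}) : p%:F = (map_poly cst p).[indet].
Proof.
elim/poly_ind: p => [|p c IHp]; first by rewrite !rmorph0 horner0.
rewrite !rmorphD !rmorphM /= map_polyX map_polyC.
by rewrite hornerD hornerMX hornerC IHp.
Qed.

Lemma rmorph_tofrac (h : {rmorphism ratfun F -> A}) p :
  h p%:F = (map_poly (h \o cst) p).[h indet].
Proof. by rewrite tofrac_horner -horner_map -map_poly_comp. Qed.

(** Equalities of morphisms on F(x), and inclusions of images of F(x), are
    reduced by this principle to the generators of the field. *)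
Lemma ratfun_ind (P : ratfun F -> Prop) :
    (forall c, P (cst c)) -> P indet ->
    (forall a b, P a -> P b -> P (a + b)) ->
    (forall a b, P a -> P b -> P (a * b)) ->
    (forall a, P a -> P a^-1) ->
  forall q, P q.
Proof.
move=> Pc PX Padd Pmul Pinv.
have Pp (p : {poly F}) : P p%:F.
  elim/poly_ind: p => [|p c IHp]; first exact: Pc 0.
  by rewrite rmorphD rmorphM; apply: (Padd); [apply: Pmul | apply: Pc].
by move=> q; have [a [b [_ ->]]] := ratfun_frac q; apply: Pmul; auto.
Qed.

Lemma rmorph_ratfun_eq (h1 h2 : {rmorphism ratfun F -> A}) :
  (forall c, h1 (cst c) = h2 (cst c)) -> h1 indet = h2 indet -> h1 =1 h2.
Proof.
move=> hc hX; elim/ratfun_ind => // [a b Ha Hb | a b Ha Hb | a Ha].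
- by rewrite !rmorphD Ha Hb.
- by rewrite !rmorphM Ha Hb.
- by rewrite !fmorphV Ha.
Qed.

Variables (h : {rmorphism F -> A}) (t : A).
Hypothesis t_trans : ~ algebraicOver h t.

Lemma transcendental_horner0 p : (map_poly h p).[t] = 0 -> p = 0.
Proof.
move=> pt0; apply/eqP/negPn/negP => p0; case: t_trans.
by exists p; rewrite // /root pt0.
Qed.

Lemma transcendental_horner_neq0 p : p != 0 -> (map_poly h p).[t] != 0.
Proof. by apply: contra_neq; apply: transcendental_horner0. Qed.

(** Evaluation at [t], computed on the canonical representative of a fraction;
    by [eval_fun_frac] every other representative gives the same value. *)
Definition eval_fun (q : ratfun F) : A :=
  let x := repr q in (map_poly h (frac x).1).[t] / (map_poly h (frac x).2).[t].

Lemma eval_fun_frac a b : b != 0 ->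
  eval_fun (a%:F / b%:F) = (map_poly h a).[t] / (map_poly h b).[t].
Proof.
move=> b0; rewrite /eval_fun; set q := a%:F / _.
have nz := transcendental_horner_neq0.
have d0 := denom_ratioP (repr q).
have /eqP := ratfun_repr q; rewrite {1}/q.
rewrite eqr_div ?tofrac_eq0 // -!rmorphM tofrac_eq => /eqP Dab.
by apply/eqP; rewrite eqr_div ?nz // -!hornerM -!rmorphM Dab mulrC eqxx.
Qed.

Lemma eval_fun_poly a : eval_fun a%:F = (map_poly h a).[t].
Proof.
rewrite -[a%:F]divr1 -tofrac1 eval_fun_frac ?oner_neq0 //.
by rewrite rmorph1 hornerC divr1.
Qed.

Fact eval_fun_zmod_morphism : zmod_morphism eval_fun.
Proof.
move=> p q; have [a [b [b0 ->]]] := ratfun_frac p.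
have [c [d [d0 ->]]] := ratfun_frac q.
have nz := transcendental_horner_neq0.
rewrite -mulNr addf_div ?tofrac_eq0 // -rmorphN -!rmorphM -rmorphD.
rewrite !eval_fun_frac ?mulf_neq0 // -mulNr addf_div ?nz //.
by rewrite !(rmorphD, rmorphM, rmorphN, hornerE).
Qed.

Fact eval_fun_monoid_morphism : monoid_morphism eval_fun.
Proof.
split=> [|p q]; first by rewrite -tofrac1 eval_fun_poly rmorph1 hornerC.
have [a [b [b0 ->]]] := ratfun_frac p; have [c [d [d0 ->]]] := ratfun_frac q.
rewrite mulf_div -!rmorphM !eval_fun_frac ?mulf_neq0 // mulf_div.
by rewrite !(rmorphM, hornerE).
Qed.

(** Transcendence of [t] is what keeps the values of denominators nonzero. *)
Lemma ratfun_evalP : exists e : {rmorphism ratfun F -> A},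
  (forall c, e (cst c) = h c) /\ e indet = t.
Proof.
pose eA := GRing.isZmodMorphism.Build _ _ _ eval_fun_zmod_morphism.
pose eM := GRing.isMonoidMorphism.Build _ _ _ eval_fun_monoid_morphism.
pose e : {rmorphism ratfun F -> A} := HB.pack eval_fun eA eM.
exists e; split=> [c|] /=; rewrite /e /= eval_fun_poly ?map_polyC ?map_polyX.
  by rewrite hornerC.
by rewrite hornerX.
Qed.

End RationalFunctions.

Lemma indet_transcendental (F A : fieldType) (h : {rmorphism ratfun F -> A}) :
  ~ algebraicOver (h \o @cst F) (h (indet F)).
Proof.
case=> p p0; rewrite /root -rmorph_tofrac fmorph_eq0 tofrac_eq0 => /eqP p0'.
by rewrite p0' eqxx in p0.
Qed.

(** * Homographies as rational functions *)

Lemma homography_comp (K : fieldType) (a b c d a' b' c' d' x : K) :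
    c' * x + d' != 0 ->
  (a * ((a' * x + b') / (c' * x + d')) + b) /
     (c * ((a' * x + b') / (c' * x + d')) + d) =
  ((a * a' + b * c') * x + (a * b' + b * d')) /
     ((c * a' + d * c') * x + (c * b' + d * d')).
Proof.
move=> v0; set v := c' * x + d' in v0 *.
have comb r t : r * ((a' * x + b') / v) + t =
    ((r * a' + t * c') * x + (r * b' + t * d')) / v.
  by apply: (mulIf v0); rewrite mulrDl mulrA !divfK // /v; ring.
by rewrite !comb invfM invrK mulrACA mulVf // mulr1.
Qed.

Section Homographies.
Variable F : fieldType.
Implicit Types (M N : GL2 F) (s : PGL2 F).

Definition homography M (z : ratfun F) : ratfun F :=
  (cst (M 0 0) * z + cst (M 0 1)) / (cst (M 1 0) * z + cst (M 1 1)).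

Lemma tofrac_linear (a b : F) :
  (a *: 'X + b%:P)%:F = cst a * indet F + cst b.
Proof. by rewrite rmorphD -mul_polyC rmorphM. Qed.

Lemma gl2_lftE M : gl2_lft M = homography M (indet F).
Proof. by rewrite /gl2_lft !tofrac_linear. Qed.

Lemma gl2_det_neq0 M : M 0 0 * M 1 1 - M 0 1 * M 1 0 != 0.
Proof.
have := gl2_unit M; rewrite unitmxE unitfE (expand_det_row _ 0) !big_ord_recl.
rewrite big_ord0 /cofactor !det_mx11 !mxE /=.
rewrite expr0 mul1r addr0 expr1 !mulN1r mulrN.
by rewrite (_ : lift _ _ = 1) 1?(_ : lift 1 0 = 0) //; apply: val_inj.
Qed.

Lemma sum_ord2 (V : nmodType) (E : 'I_2 -> V) : \sum_(i < 2) E i = E 0 + E 1.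
Proof.
by rewrite !big_ord_recl big_ord0 addr0; congr (_ + E _); apply: val_inj.
Qed.

Lemma gl2_denom_neq0 M : M 1 0 *: 'X + (M 1 1)%:P != 0.
Proof.
apply/eqP => /polyP E0; have := E0 0; have := E0 1.
rewrite !coefD !coefZ !coefX !coefC /= mulr0 mulr1 add0r addr0.
by have := gl2_det_neq0 M => /[swap] -> /[swap] ->; rewrite !mulr0 subrr eqxx.
Qed.

Lemma homography_denom_neq0 M : cst (M 1 0) * indet F + cst (M 1 1) != 0.
Proof. by rewrite -tofrac_linear tofrac_eq0 gl2_denom_neq0. Qed.

Lemma homography_gl2_lft M N : homography M (gl2_lft N) = gl2_lft (gl2_mul M N).
Proof.
rewrite !gl2_lftE {1 2}/homography homography_comp ?homography_denom_neq0 //.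
rewrite /homography; have De i k : cst (gl2_mul M N i k) =
    cst (M i 0) * cst (N 0 k) + cst (M i 1) * cst (N 1 k).
  by rewrite mxE sum_ord2 rmorphD !rmorphM.
by rewrite !De.
Qed.

Lemma pi_mulg M N :
  (\pi_(PGL2 F)%qT M * \pi_(PGL2 F)%qT N)%g = \pi_(PGL2 F)%qT (gl2_mul M N).
Proof. exact/esym/pi_PGL2_mul. Qed.

Lemma pi_invg M : ((\pi_(PGL2 F)%qT M)^-1)%g = \pi_(PGL2 F)%qT (gl2_inv M).
Proof. exact/esym/pi_PGL2_inv. Qed.

Lemma lft_one : lft (1%g : PGL2 F) = indet F.
Proof.
rewrite (_ : 1%g = \pi_(PGL2 F) (gl2_one F))%qT; last first.
  exact: (piE (PGL2_one_morph F)).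
rewrite lft_pi gl2_lftE /homography /= !mxE /= !rmorph0 !rmorph1.
by rewrite mul0r mul1r add0r addr0 divr1.
Qed.

Lemma rmorph_homography (A : fieldType) (h : {rmorphism ratfun F -> A}) M z :
  h (homography M z) = (h (cst (M 0 0)) * h z + h (cst (M 0 1))) /
                       (h (cst (M 1 0)) * h z + h (cst (M 1 1))).
Proof. by rewrite fmorph_div !rmorphD !rmorphM. Qed.

(** The substitution of t(x) turns s(x) into s(t(x)), so [t] is multiplied
    on the right: this is also the order in which Galois groups compose,
    whence an isomorphism, and not an anti-isomorphism, in [isog_gal_orbit]. *)
Lemma lft_subst (e : {rmorphism ratfun F -> ratfun F}) s t :
    (forall c, e (cst c) = cst c) -> e (indet F) = lft t ->
  e (lft s) = lft (s * t)%g.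
Proof.
move=> ec; elim/quotW: s => M; elim/quotW: t => N.
rewrite !lft_pi => eX; rewrite gl2_lftE rmorph_homography !ec eX.
by rewrite -[LHS]/(homography M _) homography_gl2_lft -lft_pi pi_PGL2_mul.
Qed.

Lemma lft_map (sigma : {rmorphism F -> F})
    (e : {rmorphism ratfun F -> ratfun F}) s :
    (forall c, e (cst c) = cst (sigma c)) -> e (indet F) = indet F ->
  e (lft s) = lft (PGL2_map sigma s).
Proof.
move=> ec eX; elim/quotW: s => M; rewrite -pi_PGL2_map !lft_pi !gl2_lftE.
by rewrite rmorph_homography !ec eX /homography !mxE.
Qed.

(** The indeterminate is recovered from s(x) by the inverse homography, so it
    would be algebraic if s(x) were. *)
Lemma lft_transcendental s : ~ algebraicOver (@cst F) (lft s).
Proof.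
have cstN := algebraic_id (@cst F).
move=> s_alg; suff: algebraicOver (@cst F) (indet F).
  exact: (@indet_transcendental F _ idfun).
rewrite -lft_one -(mulVg s); elim/quotW: s s_alg => M s_alg.
rewrite pi_invg pi_mulg lft_pi -homography_gl2_lft -lft_pi.
have lin a b : algebraicOver (@cst F) (cst a * lft (\pi_(PGL2 F)%qT M) + cst b).
  by apply: algebraic_add (cstN b); apply: algebraic_mul (cstN a) s_alg.
exact: algebraic_div (lin _ _) (lin _ _).
Qed.

Lemma lft_inj : injective (@lft F).
Proof.
move=> s t; elim/quotW: s => M; elim/quotW: t => N; rewrite !lft_pi => /eqP.
rewrite eqr_div ?tofrac_eq0 ?gl2_denom_neq0 // -!rmorphM tofrac_eq => /eqP.
set a := M 0 0; set b := M 0 1; set c := M 1 0; set d := M 1 1.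
set a' := N 0 0; set b' := N 0 1; set c' := N 1 0; set d' := N 1 1 => MN.
have detM : a * d - b * c != 0 := gl2_det_neq0 M.
have detN : a' * d' - b' * c' != 0 := gl2_det_neq0 N.
have expand (r t u v : F) : (r *: 'X + t%:P) * (u *: 'X + v%:P) =
    (r * u) *: 'X^2 + (r * v + t * u) *: 'X + (t * v)%:P :> {poly F}.
  by rewrite -!mul_polyC !rmorphD !rmorphM /=; ring.
move/polyP: MN => MN; move: (MN 0) (MN 1) (MN 2); rewrite !expand.
rewrite !coefD !coefZ !coefXn !coefX !coefC /= !mulr0 !mulr1 !add0r !addr0.
move=> E0 E1 E2.
have {}E0 : b * d' - b' * d = 0 by rewrite E0 subrr.
have {}E1 : a * d' + b * c' - (a' * d + b' * c) = 0 by rewrite E1 subrr.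
have {}E2 : a * c' - a' * c = 0 by rewrite E2 subrr.
(* The three identities say that the adjugate of M times N is the scalar
   matrix l; multiplying by M on the left gives m N = l M, where m = det M. *)
pose m := a * d - b * c; pose l := d * a' - b * c'.
have solve u v : v * m - l * u = 0 -> v = l / m * u.
  by move/subr0_eq=> vm; apply: (mulIf detM); rewrite vm mulrAC divfK.
have Da : a' = l / m * a.
  by apply: solve; rewrite -(mulr0 b) -E2 /m /l; ring.
have Db : b' = l / m * b.
  apply: solve; transitivity (b * 0 - a * 0); last by rewrite !mulr0 subrr.
  by rewrite -{1}E1 -E0 /m /l; ring.
have Dc : c' = l / m * c.
  by apply: solve; rewrite -(mulr0 d) -E2 /m /l; ring.
have Dd : d' = l / m * d.
  apply: solve; transitivity (d * 0 - c * 0); last by rewrite !mulr0 subrr.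
  by rewrite -{1}E1 -E0 /m /l; ring.
apply/eqP/pi_PGL2P; exists (l / m).
  by apply: contraNneq detN => lm0; rewrite Da Db lm0 !mul0r subrr.
have ord2P (i : 'I_2) : i = 0 \/ i = 1.
  by case: i => [[|[|//]] ?]; [left | right]; apply: val_inj.
apply/matrixP=> i k; rewrite mxE.
by case: (ord2P i) => ->; case: (ord2P k) => ->.
Qed.

End Homographies.

(** * Coefficients of the orbit polynomial *)

Section OrbitPolynomial.
Variables (F : fieldType) (G : {fset PGL2 F}).

(** The endomorphism [e] permutes the roots of the orbit polynomial: it maps the
    finite set of roots injectively to itself. *)
Lemma map_orbit_poly (e : {rmorphism ratfun F -> ratfun F})
    (m : PGL2 F -> PGL2 F) :
    {in G, forall s, m s \in G} -> {in G, forall s, e (lft s) = lft (m s)} ->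
  map_poly e (orbit_poly G) = orbit_poly G.
Proof.
move=> mG em; have m_inj : {in G &, injective m}.
  move=> s t Gs Gt mst; apply/lft_inj/(fmorph_inj e).
  by rewrite (em s Gs) (em t Gt) mst.
have m_perm : perm_eq [seq m s | s <- G] G.
  have m_uniq : uniq [seq m s | s <- G] by rewrite map_inj_in_uniq ?fset_uniq.
  rewrite uniq_perm ?fset_uniq //.
  have sub_mG : {subset [seq m s | s <- G] <= G}.
    by move=> _ /mapP[s Gs ->]; apply: mG.
  by case: (uniq_min_size m_uniq sub_mG) => //; rewrite size_map.
rewrite /orbit_poly rmorph_prod /= -[RHS](perm_big _ m_perm) big_map.
apply: eq_big_seq => s Gs.
by rewrite map_polyXsubC; congr ('X - _%:P); apply: em.
Qed.

Lemma size_coef_prod_linear (I : Type) (r : seq I) (u v : I -> {poly F})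
    (i : nat) :
    (forall s, size (u s) <= 2)%N -> (forall s, size (v s) <= 2)%N ->
  (size ((\prod_(s <- r) ((v s)%:P * 'X - (u s)%:P))`_i)%R <= (size r).+1)%N.
Proof.
move=> su sv; elim: r i => [|s r IHr] i.
  by rewrite big_nil coef1; case: eqP => _ /=; rewrite (size_poly1, size_poly0).
set Q := \prod_(t <- r) _ in IHr.
have step (p : {poly F}) k :
    (size p <= 2 -> size (p * Q`_k)%R <= (size r).+2)%N.
  move=> sp; apply: leq_trans (size_polyMleq _ _) _.
  by rewrite -subn1 leq_subLR (leq_trans (leq_add sp (IHr k))) // add1n addnS.
rewrite big_cons -/Q mulrBl coefB -mulrA !coefCM coefXM.
apply: leq_trans (size_polyD _ _) _; rewrite size_polyN geq_max !step // andbT.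
by case: eqP => _; rewrite ?mulr0 ?size_poly0 ?step.
Qed.

(** Multiplied by the product [D] of the denominators cx + d of the s(x), the
    orbit polynomial has its coefficients in F[x], of degree at most |G| since
    each factor (cx + d)T - (ax + b) is linear in x.  As f/g is in lowest terms,
    [f] divides such a coefficient and [g] divides [D]. *)
Lemma orbit_poly_coef_size (f g : {poly F}) i :
    coprimep f g -> f != 0 -> g != 0 -> (orbit_poly G)`_i = f%:F / g%:F ->
  (size f <= #|` G|.+1)%N /\ (size g <= #|` G|.+1)%N.
Proof.
move=> co_fg f0 g0 Dfg.
pose u (s : PGL2 F) : {poly F} := repr s 0 0 *: 'X + (repr s 0 1)%:P.
pose v (s : PGL2 F) : {poly F} := repr s 1 0 *: 'X + (repr s 1 1)%:P.
have co_gf : coprimep g f by rewrite coprimep_sym.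
have size_lin (a b : F) : (size (a *: 'X + b%:P)%R <= 2)%N.
  rewrite (leq_trans (size_polyD _ _)) // geq_max.
  rewrite (leq_trans (size_scale_leq _ _)) ?size_polyX //.
  by rewrite (leq_trans (size_polyC_leq1 _)).
have v0 s : v s != 0 := gl2_denom_neq0 (repr s).
pose D := \prod_(s <- G) v s.
pose Q : {poly {poly F}} := \prod_(s <- G) ((v s)%:P * 'X - (u s)%:P).
have D0 : D != 0 by rewrite prodf_seq_neq0; apply/allP=> s _; rewrite v0.
have DQ : map_poly (@FracField.tofrac _) Q = D%:F *: orbit_poly G.
  rewrite /Q /D /orbit_poly !rmorph_prod -mul_polyC rmorph_prod -big_split /=.
  apply: eq_bigr => s _; rewrite rmorphB rmorphM /= map_polyX !map_polyC /=.
  rewrite mulrBr mul_polyC -polyCM /lft /gl2_lft -/(u s) -/(v s).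
  by rewrite mulrC divfK // tofrac_eq0.
have {}DQ : Q`_i * g = D * f.
  apply/eqP; rewrite -tofrac_eq !tofracM -coef_map DQ coefZ Dfg.
  by rewrite -mulrA divfK // tofrac_eq0.
have Qi0 : Q`_i != 0.
  apply: contraTneq isT => Q0; move/eqP: DQ.
  by rewrite Q0 mul0r eq_sym mulf_eq0 (negPf D0) (negPf f0).
have size_D : (size D <= #|` G|.+1)%N.
  rewrite /D; elim: (enum_fset G) => [|s r IHr].
    by rewrite big_nil size_poly1.
  rewrite big_cons (leq_trans (size_polyMleq _ _)) // -subn1 leq_subLR.
  by rewrite (leq_trans (leq_add (size_lin _ _) IHr)) // add1n addnS.
have size_Q : (size (Q`_i)%R <= #|` G|.+1)%N.
  by apply: size_coef_prod_linear => s; apply: size_lin.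
split.
  apply: leq_trans size_Q; apply: dvdp_leq => //.
  by rewrite -(Gauss_dvdpl _ co_fg) DQ dvdp_mull.
apply: leq_trans size_D; apply: dvdp_leq => //.
by rewrite -(Gauss_dvdpl _ co_gf) -DQ dvdp_mull.
Qed.

End OrbitPolynomial.

(** By coprimality [f] divides its image under [sigma], which has the same
    degree, and likewise for [g]; so both are multiplied by scalars. The
    scalars agree, and the one that belongs to a monic polynomial is 1. *)
Lemma map_poly_frac_fixed (F : fieldType) (sigma : {rmorphism F -> F})
    (f g : {poly F}) :
    coprimep f g -> f != 0 -> g != 0 -> (f \is monic) || (g \is monic) ->
    map_poly sigma f * g = f * map_poly sigma g ->
  map_poly sigma f = f /\ map_poly sigma g = g.
Proof.
move=> co_fg f0 g0 mon E.
have f_sf : f %| map_poly sigma f by rewrite -(Gauss_dvdpl _ co_fg) E dvdp_mulr.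
have g_sg : g %| map_poly sigma g.
  by rewrite -(Gauss_dvdpr _ (_ : coprimep g f)) 1?coprimep_sym // -E dvdp_mull.
have scaled (h : {poly F}) : h != 0 -> h %| map_poly sigma h ->
    exists c, map_poly sigma h = c *: h.
  move=> h0 h_sh; have /eqpP[[c d] /= /andP[c0 d0] Dh] : h %= map_poly sigma h.
    by rewrite -dvdp_size_eqp // size_map_poly.
  by exists (d^-1 * c); rewrite -scalerA Dh scalerA mulVf // scale1r.
have [[c Df] [d Dg]] := (scaled f f0 f_sf, scaled g g0 g_sg).
have Dcd : c = d.
  apply/eqP; rewrite -subr_eq0; apply: contraTT isT => cd0 /=.
  move/eqP: E; rewrite Df Dg -scalerAl -scalerAr -subr_eq0 -scalerBl scaler_eq0.
  by rewrite (negPf cd0) mulf_eq0 (negPf f0) (negPf g0).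
have c1 (h : {poly F}) : h \is monic -> map_poly sigma h = c *: h -> c = 1.
  move=> /monicP mh /(congr1 lead_coef).
  by rewrite lead_coef_map lead_coefZ mh rmorph1 mulr1.
by case/orP: mon => mon; rewrite Df Dg -Dcd (c1 _ mon) ?scale1r // Dcd.
Qed.

(** * Galois groups *)

Section Transport.
Variables (k : fieldType) (Omega : splittingFieldType k) (M : {subfield Omega}).
Variables (A : fieldType) (i : {rmorphism A -> Omega}) (e : {rmorphism A -> A}).
Hypothesis M_image : forall z, z \in M <-> exists q, z = i q.
Hypothesis e_base : forall c q, i q = c%:A -> e q = q.

(** The composite [i] [e] [i]^-1 is linear over the base field, because [e]
    fixes the part of [A] that [i] maps to it. It maps [M] to itself
    injectively, hence onto since [M] has finite dimension. As Galois groups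
    consist of restrictions of endomorphisms of [Omega], it is first
    extended to [Omega] by a linear projection onto [M]. *)
Lemma gal_transport :
  exists2 x : gal_of M, x \in 'Gal(M / 1)%g & forall q, x (i q) = i (e q).
Proof.
have preimage (v : subvs_of M) : exists q, vsval v == i q.
  by have /M_image[q Dq] := subvsP v; exists q; rewrite Dq.
pose pre v : A := xchoose (preimage v).
have preE v : i (pre v) = vsval v by rewrite -(eqP (xchooseP (preimage v))).
pose phi (v : subvs_of M) : Omega := i (e (pre v)).
have phi_lin : linear phi.
  move=> c u v; have /M_image[q Dq] : c%:A \in M by rewrite rpredZ ?rpred1.
  rewrite /phi; set w := (_ + v)%R; have -> : pre w = q * pre u + pre v.
    apply: (fmorph_inj i); rewrite rmorphD rmorphM /= !preE /w linearP /=.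
    by rewrite -Dq mulr_algl.
  by rewrite !(rmorphD, rmorphM) /= (e_base (esym Dq)) -Dq mulr_algl.
pose phiL := GRing.isLinear.Build _ _ _ _ phi phi_lin.
pose phi' : {linear subvs_of M -> Omega} := HB.pack phi phiL.
pose x0 : 'End(Omega) := (linfun phi' \o linfun (vsproj M))%VF.
have x0i q : x0 (i q) = i (e q).
  have Miq : i q \in M by apply/M_image; exists q.
  rewrite comp_lfunE !lfunE /= /phi; congr (i (e _)); apply: (fmorph_inj i).
  by rewrite preE vsprojK.
have x0_aut : kAut 1 M x0.
  rewrite kAutE; apply/andP; split.
    apply/kHomP_tmp.
    split=> [_ /vlineP[c ->] | _ _ /M_image[p ->] /M_image[q ->]].
      have /M_image[q Dq] : c%:A \in M by rewrite rpredZ ?rpred1.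
      by rewrite Dq x0i (e_base (esym Dq)).
    by rewrite -rmorphM !x0i !rmorphM.
  apply/subvP => _ /memv_imgP[z /M_image[q ->] ->]; rewrite x0i.
  by apply/M_image; exists (e q).
have [x Gx Dx] := kAut_to_gal x0_aut.
by exists x => // q; rewrite -Dx ?x0i //; apply/M_image; exists q.
Qed.

End Transport.

Lemma galois_trivial_gal (k : fieldType) (Omega : splittingFieldType k)
    (L M : {subfield Omega}) :
  galois L M -> 'Gal(M / L)%g = 1%g -> L = M.
Proof.
move=> /galois_fixedField fixL Gal1.
apply/val_inj/(etrans (esym fixL)); rewrite Gal1.
apply/eqP; rewrite eqEsubv fixedField_bound; apply/subvP=> z Mz.
by apply/fixedFieldP=> // x /set1P->; rewrite gal_id.
Qed.

Section Complement.
Variables (k : fieldType) (Omega : splittingFieldType k).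
Variables (L : {subfield Omega}) (y : Omega).
Let M := <<L; y>>%AS.
Variable K : {group gal_of M}.
Hypothesis galM_L : galois L M.
Hypothesis K_y : forall x, x \in K -> x y = y.
Hypothesis K_L : forall x, x \in K -> {in L, forall z, x z \in L}.
Hypothesis K_fixed : {in L, forall z, (forall x, x \in K -> x z = z) ->
  z \in 1%AS}.

Lemma Fadjoin_normaliser : K \subset 'N('Gal(M / L))%g.
Proof.
apply/subsetP=> x Kx; rewrite inE gal_conjg //.
suff -> : (x @: L)%VS = L by [].
apply/eqP; rewrite eqEdim (kHom_dim (K := 1%AS)) ?k1AHom // leqnn andbT.
by apply/subvP=> _ /memv_imgP[z Lz ->]; apply: K_L.
Qed.

Let fixed_join : fixedField ('Gal(M / L) <*> K)%g = 1%VS.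
Proof.
apply/eqP; rewrite eqEsubv sub1v andbT.
apply/subvP=> z /mem_fixedFieldP[Mz fix_z].
apply: K_fixed => [|x Kx].
  rewrite -(galois_fixedField galM_L); apply/fixedFieldP => // x Lx.
  by apply: fix_z; rewrite mem_gen // inE Lx.
by apply: fix_z; rewrite mem_gen // inE Kx orbT.
Qed.

Lemma Fadjoin_galois : galois 1%AS M.
Proof.
by have := fixedField_galois ('Gal(M / L) <*> K)%g; rewrite /= fixed_join.
Qed.

(** An automorphism of [M] that fixes both [L] and [y] is trivial. An
    element of [M] fixed by Gal(M/L) and by [K] is in [L], hence in the base
    field, so the group generated by both is Gal(M/1) by the Galois
    correspondence. *)
Lemma Fadjoin_complement :
  K \in [complements to 'Gal(M / L) in 'Gal(M / 1)]%g.
Proof.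
apply/complP; split.
  apply/trivgP/subsetP=> x /setIP[Lx Kx].
  by rewrite inE (gal_adjoin_eq Lx (group1 _)) gal_id K_y.
rewrite -norm_joinEr ?Fadjoin_normaliser //.
by rewrite -(gal_fixedField ('Gal(M / L) <*> K)%G) fixed_join.
Qed.

End Complement.

(** * Substitutions, and actions on coefficients *)

Section Endomorphisms.
Variable F : fieldType.

Lemma subst_endo (s : PGL2 F) : exists e : {rmorphism ratfun F -> ratfun F},
  (forall c, e (cst c) = cst c) /\ e (indet F) = lft s.
Proof. exact: ratfun_evalP (@lft_transcendental F s). Qed.

Lemma coef_endo (sigma : {rmorphism F -> F}) :
  exists e : {rmorphism ratfun F -> ratfun F},
  (forall c, e (cst c) = cst (sigma c)) /\ e (indet F) = indet F.
Proof.
apply: (@ratfun_evalP F _ (@cst F \o sigma)) => -[p p0 px].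
apply: (@indet_transcendental F _ idfun); exists (map_poly sigma p).
  by rewrite map_poly_eq0.
by rewrite -map_poly_comp.
Qed.

Lemma coef_endo_poly (sigma : {rmorphism F -> F})
    (e : {rmorphism ratfun F -> ratfun F}) (p : {poly F}) :
    (forall c, e (cst c) = cst (sigma c)) -> e (indet F) = indet F ->
  e p%:F = (map_poly sigma p)%:F.
Proof.
move=> ec ex; rewrite rmorph_tofrac ex tofrac_horner -map_poly_comp.
by congr _.[_]; apply: eq_map_poly => c; apply: ec.
Qed.

End Endomorphisms.

(** * Roots of f(T) - x g(T) *)

Lemma algebraic_horner (F E : fieldType) (h : {rmorphism F -> E})
    (p : {poly F}) y :
  algebraicOver h y -> algebraicOver h (map_poly h p).[y].
Proof.
move=> y_alg; elim/poly_ind: p => [|p c IHp].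
  by rewrite rmorph0 horner0; apply: algebraic0.
rewrite rmorphD rmorphM /= map_polyX map_polyC hornerD hornerMX hornerC.
by apply: algebraic_add (algebraic_id _ _); apply: algebraic_mul.
Qed.

Section Fiber.
Variables (F A : fieldType) (j : {rmorphism ratfun F -> A}) (f g : {poly F}).
Hypothesis co_fg : coprimep f g.
Hypothesis nonconst_fg : forall c : F, f%:F / g%:F <> cst c.
Let p := map_poly j (fiber_poly f g).

Lemma fiberE :
  p = map_poly (j \o @cst F) f - j (indet F) *: map_poly (j \o @cst F) g.
Proof. by rewrite /p /fiber_poly rmorphB /= map_polyZ -!map_poly_comp. Qed.

Lemma fiber_num_neq0 : f != 0.
Proof.
by apply/eqP=> f0; apply: (nonconst_fg (c := 0)); rewrite f0 !rmorph0 mul0r.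
Qed.

Lemma fiber_den_neq0 : g != 0.
Proof.
apply/eqP=> g0; apply: (nonconst_fg (c := 0)).
by rewrite g0 !rmorph0 invr0 mulr0.
Qed.

Lemma fiber_coef_eq0 k : p`_k = 0 -> f`_k = 0 /\ g`_k = 0.
Proof.
rewrite fiberE coefB coefZ !coef_map /= -rmorphM -rmorphB => /eqP.
rewrite fmorph_eq0 => /eqP E.
have: ((f`_k)%:P - 'X * (g`_k)%:P)%:F == 0 by rewrite rmorphB rmorphM E.
rewrite tofrac_eq0 => /eqP/polyP{}E; have := E 0; have := E 1%N.
rewrite !coefB !coefXM !coefC /= subr0 sub0r => /eqP; rewrite oppr_eq0.
by move=> /eqP -> ->.
Qed.

Lemma fiber_size_gt1 : (1 < size p)%N.
Proof.
rewrite ltnNge; apply/negP => size_p.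
have [Df Dg] : f = (f`_0)%:P /\ g = (g`_0)%:P.
  have coef0 k := fiber_coef_eq0 (nth_default 0 (leq_trans size_p (ltn0Sn k))).
  by split; apply/polyP => -[|k]; rewrite coefC //= ?(coef0 k).1 ?(coef0 k).2.
apply: (nonconst_fg (c := f`_0 / g`_0)).
by rewrite fmorph_div {1}Df {1}Dg.
Qed.

(** If [y] is algebraic over [F], so is x = f(y)/g(y). *)
Lemma fiber_root_transcendental y : root p y -> ~ algebraicOver (j \o @cst F) y.
Proof.
rewrite /root fiberE hornerD hornerN hornerZ subr_eq0 => /eqP fy y_alg.
have gy0 : (map_poly (j \o @cst F) g).[y] != 0.
  apply/eqP => gy; have := co_fg; rewrite -(coprimep_map (j \o @cst F)).
  move=> /coprimep_root/(_ (_ : root _ y)); rewrite /root fy gy mulr0 eqxx.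
  by move=> /(_ isT)/eqP.
apply: (@indet_transcendental F A j).
rewrite -(mulfK gy0 (j _)) -fy.
by apply: algebraic_div; apply: algebraic_horner.
Qed.

Lemma fiber_root_embedding y : root p y ->
  exists i : {rmorphism ratfun F -> A},
    [/\ forall c, i (cst c) = j (cst c), i (indet F) = y
      & i (f%:F / g%:F) = j (indet F)].
Proof.
move=> py; have [i [ic iX]] := ratfun_evalP (fiber_root_transcendental py).
exists i; split=> //; have iE q : i q%:F = (map_poly (j \o @cst F) q).[y].
  by rewrite rmorph_tofrac iX; congr _.[_]; apply: eq_map_poly.
rewrite fmorph_div !iE; apply: canLR (mulfK _) _.
  by rewrite -iE fmorph_eq0 tofrac_eq0 fiber_den_neq0.
by move: py; rewrite /root fiberE hornerD hornerN hornerZ subr_eq0 => /eqP ->.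
Qed.

Variables (i : {rmorphism ratfun F -> A}).
Hypothesis ic : forall c, i (cst c) = j (cst c).
Hypothesis ifg : i (f%:F / g%:F) = j (indet F).

Lemma fiber_root_lft (e : {rmorphism ratfun F -> ratfun F}) :
    (forall c, e (cst c) = cst c) -> e (f%:F / g%:F) = f%:F / g%:F ->
  root p (i (e (indet F))).
Proof.
move=> ec efg; have iE q :
    i (e q%:F) = (map_poly (j \o @cst F) q).[i (e (indet F))].
  rewrite -[LHS]/((i \o e) _) rmorph_tofrac /=.
  by congr _.[_]; apply: eq_map_poly => c /=; rewrite ec ic.
rewrite /root fiberE hornerD hornerN hornerZ -!iE -ifg -efg -rmorphM.
by rewrite -rmorphM divfK ?subrr // tofrac_eq0 fiber_den_neq0.
Qed.

(** By [ifg], the morphism [j] is [i] precomposed with the substitution of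
    f/g for the indeterminate. So an endomorphism [e] that acts by [sigma]
    on constants and fixes f/g induces, through [i], the coefficientwise
    action of [sigma] on the image of [j], no matter how it moves the
    indeterminate. *)
Lemma fiber_embed (sigma : F -> F) (t e : {rmorphism ratfun F -> ratfun F}) :
    (forall c, t (cst c) = cst (sigma c)) -> t (indet F) = indet F ->
    (forall c, e (cst c) = cst (sigma c)) -> e (f%:F / g%:F) = f%:F / g%:F ->
  forall q, exists r, j q = i r /\ j (t q) = i (e r).
Proof.
move=> tc tX ec efg; elim/ratfun_ind => [c||a b [a' [Da Ea]] [b' [Db Eb]]
    |a b [a' [Da Ea]] [b' [Db Eb]]|a [a' [Da Ea]]].
- by exists (cst c); rewrite tc ec !ic.
- by exists (f%:F / g%:F); rewrite tX efg ifg.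
- by exists (a' + b'); rewrite !rmorphD Da Ea Db Eb.
- by exists (a' * b'); rewrite !rmorphM Da Ea Db Eb.
- by exists a'^-1; rewrite !fmorphV Da Ea.
Qed.

End Fiber.

(** * Descent to the fixed field *)

Section FixedField.
Variables (F : fieldType) (hT : finGroupType) (H : hT -> {rmorphism F -> F}).
Hypothesis Haut : faithful_aut H.
Let E := fixed_field H.

Lemma faithful_aut1 c : H 1%g c = c.
Proof.
by apply: (fmorph_inj (H 1%g)); rewrite -[LHS](Haut.1 1%g 1%g c) mulg1.
Qed.

Lemma polyOver_fixedP (p : {poly F}) :
  p \is a polyOver (fixed H) <-> forall u, map_poly (H u) p = p.
Proof.
split=> [/allP Ep u | Ep].
  apply/polyP=> k; rewrite coef_map; have [lt_kp | le_pk] := ltnP k (size p).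
    by have /forallP/(_ u)/eqP := Ep _ (mem_nth 0 lt_kp).
  by rewrite (nth_default 0 le_pk) raddf0.
apply/allP=> _ /(nthP 0)[k _ <-]; apply/forallP=> u.
by rewrite -coef_map Ep.
Qed.

Lemma polyOver_fixed_lift (p : {poly F}) :
  p \is a polyOver (fixed H) -> exists q : {poly E}, p = map_poly val q.
Proof.
move=> /polyOver_fixedP Ep; have {}Ep k : p`_k \in fixed H.
  by apply/forallP=> u; rewrite -coef_map Ep.
exists (map_poly (insubd (0 : E)) p); apply/polyP=> k.
rewrite !coef_map_id0 ?insubdK ?Ep ?rmorph0 //.
apply: val_inj; rewrite insubdK //.
by apply/forallP=> u; rewrite rmorph0.
Qed.

Variables (tau : hT -> {rmorphism ratfun F -> ratfun F}).
Hypothesis tauc : forall u c, tau u (cst c) = cst (H u c).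
Hypothesis tauX : forall u, tau u (indet F) = indet F.

(** Multiplying numerator and denominator by the conjugates of the denominator
    replaces the latter with its norm, which is invariant; the new numerator is
    then invariant as well. *)
Lemma coef_fixed_frac q : (forall u, tau u q = q) ->
  exists a b : {poly F}, [/\ a \is a polyOver (fixed H),
    b \is a polyOver (fixed H), b != 0 & q = a%:F / b%:F].
Proof.
move=> tau_q; have [a [b [b0 Dq]]] := ratfun_frac q.
pose N := \prod_u map_poly (H u) b.
have N0 : N != 0 by apply/prodf_neq0 => u _; rewrite map_poly_eq0.
have EN : N \is a polyOver (fixed H).
  apply/polyOver_fixedP=> v; rewrite rmorph_prod /N.
  rewrite [RHS](reindex_inj (mulgI v)); apply: eq_bigr => u _ /=.
  by rewrite -map_poly_comp; apply: eq_map_poly => c; rewrite Haut.1.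
pose a' := a * \prod_(u | u != 1%g) map_poly (H u) b.
have Da' : q * N%:F = a'%:F.
  rewrite /N (bigD1 1%g) //= (eq_map_poly faithful_aut1) map_poly_id //.
  by rewrite rmorphM mulrA Dq divfK ?tofrac_eq0 // -rmorphM.
exists a', N; split=> //; last by rewrite -Da' mulfK ?tofrac_eq0.
apply/polyOver_fixedP=> u; apply/eqP; rewrite -tofrac_eq.
rewrite -(coef_endo_poly _ (tauc u) (tauX u)) -Da' rmorphM tau_q.
by rewrite (coef_endo_poly _ (tauc u) (tauX u)) (polyOver_fixedP N).1.
Qed.

Variables (Omega : fieldExtType (ratfun E)) (j : {rmorphism ratfun F -> Omega}).
Hypothesis jE : forall p : {poly E}, j (map_poly val p)%:F = in_alg Omega p%:F.

Lemma coef_fixed_base q : (forall u, tau u q = q) -> exists c, j q = c%:A.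
Proof.
case/coef_fixed_frac=> a [b [/polyOver_fixed_lift[a' ->]]].
move=> /polyOver_fixed_lift[b' ->] _ ->; exists (a'%:F / b'%:F).
by rewrite fmorph_div /= !jE -fmorph_div.
Qed.

Lemma base_coef_fixed c : exists q, c%:A = j q /\ forall u, tau u q = q.
Proof.
have [a [b [_ ->]]] := ratfun_frac c.
exists ((map_poly val a)%:F / (map_poly val b)%:F); split.
  by rewrite fmorph_div !jE -fmorph_div.
have fixp (p : {poly E}) u : tau u (map_poly val p)%:F = (map_poly val p)%:F.
  rewrite (coef_endo_poly _ (tauc u) (tauX u)) (polyOver_fixedP _).1 //.
  apply/polyOver_fixedP=> v; rewrite -map_poly_comp; apply: eq_map_poly => e.
  by apply/eqP; move/forallP: (valP e); apply.
by move=> u; rewrite fmorph_div !fixp.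
Qed.

Variable (G : {fset PGL2 F}).
Hypothesis Gfull : forall K : {pred F}, divring_closed K ->
  (exists a : F, a \notin K) -> ~ defined_over K G.

(** If [H u] fixes the class of a matrix, it multiplies all the entries by the
    same scalar, so it fixes their ratios.  If it does so for every element of
    [G], then [G] is defined over the subfield fixed by [H u]. *)
Lemma PGL2_map_faithful u :
  (forall s, s \in G -> PGL2_map (H u) s = s) -> u = 1%g.
Proof.
move=> uG; apply: Haut.2 => c; rewrite faithful_aut1.
apply/eqP/negPn/negP => uc.
pose K : {pred F} := [pred a | H u a == a].
apply: (@Gfull K); last 1 first.
- move=> M /uG; rewrite -pi_PGL2_map => /esym/eqP/pi_PGL2P[e e0 De].
  have [i [k Mik]] : exists i k, M i k != 0.
    have := gl2_det_neq0 M.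
    have [M00 | ] := eqVneq (M 0 0) 0; last by exists 0, 0.
    have [M01 | ] := eqVneq (M 0 1) 0; last by exists 0, 1.
    by rewrite M00 M01 !mul0r subrr eqxx.
  exists i, k; split=> // i' k'; rewrite inE fmorph_div; apply/eqP.
  have eM r t : H u (M r t) = e * M r t.
    by have /matrixP/(_ r t) := De; rewrite !mxE.
  by rewrite !eM -mulf_div divff ?mul1r.
- split=> [|a b /eqP Ka /eqP Kb|a b /eqP Ka /eqP Kb]; rewrite inE.
  + by rewrite rmorph1.
  + by rewrite rmorphB Ka Kb.
  + by rewrite fmorph_div Ka Kb.
by exists c.
Qed.

End FixedField.

(** * The splitting field and its Galois group *)

(** The s(y) are |G| distinct roots, and the degree is at most |G|. *)
Lemma fiber_poly_factor (F A : fieldType) (G : {fset PGL2 F}) (k : nat)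
    (j i : {rmorphism ratfun F -> A}) (f g : {poly F}) :
    coprimep f g -> (forall c, f%:F / g%:F <> cst c) ->
    (orbit_poly G)`_k = f%:F / g%:F ->
    (forall c, i (cst c) = j (cst c)) -> i (f%:F / g%:F) = j (indet F) ->
    (forall s, s \in G -> exists e : {rmorphism ratfun F -> ratfun F},
      [/\ forall c, e (cst c) = cst c, e (indet F) = lft s
        & e (f%:F / g%:F) = f%:F / g%:F]) ->
  map_poly j (fiber_poly f g)
    %= \prod_(z <- [seq i (lft s) | s <- G]) ('X - z%:P).
Proof.
move=> co_fg nonconst Dfg ic ifg Ge; set p := map_poly j _.
set rs := [seq _ | s <- _].
have [f0 g0] := (fiber_num_neq0 nonconst, fiber_den_neq0 nonconst).
have [size_f size_g] := orbit_poly_coef_size co_fg f0 g0 Dfg.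
have size_p : (size p <= (size rs).+1)%N.
  rewrite size_map /p fiberE (leq_trans (size_polyD _ _)) // size_polyN geq_max.
  rewrite size_map_poly size_f (leq_trans (size_scale_leq _ _)) //.
  by rewrite size_map_poly.
have p0 : p != 0.
  by rewrite -size_poly_gt0 (ltn_trans _ (fiber_size_gt1 j nonconst)).
have p_rs : all (root p) rs.
  apply/allP=> _ /mapP[s /Ge[e [ec eX efg]] ->].
  by rewrite -eX; apply: fiber_root_lft.
have rs_uniq : uniq rs.
  by rewrite map_inj_uniq ?fset_uniq // => s t /fmorph_inj/lft_inj.
have {}size_p : size p = (size rs).+1.
  by apply/eqP; rewrite eqn_leq size_p (max_poly_roots p0 p_rs rs_uniq).
rewrite (all_roots_prod_XsubC size_p p_rs) ?uniq_rootsE //.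
by rewrite eqp_scale // lead_coef_eq0.
Qed.

Lemma Fadjoin_image (F k : fieldType) (Omega : fieldExtType k)
    (i j : {rmorphism ratfun F -> Omega}) (Fx : {subfield Omega}) :
    (forall z, z \in Fx <-> exists q, z = j q) ->
    (forall q, exists r, j q = i r) -> (forall c, i (cst c) \in Fx) ->
  forall z, z \in <<Fx; i (indet F)>>%AS <-> exists q, z = i q.
Proof.
move=> FxP j_image Fx_cst z; split=> [/Fadjoin_polyP[q Fx_q ->] | [q ->]].
  rewrite horner_coef; elim/big_ind: _ => [|_ _ [a ->] [b ->]|m _].
  - by exists 0; rewrite rmorph0.
  - by exists (a + b); rewrite rmorphD.
  have /polyOverP/(_ m)/FxP[r ->] := Fx_q; have [a ->] := j_image r.
  by exists (a * indet F ^+ m); rewrite rmorphM rmorphXn.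
elim/ratfun_ind: q => [c||a b Ma Mb|a b Ma Mb|a Ma].
- exact: subvP_adjoin.
- exact: memv_adjoin.
- by rewrite rmorphD rpredD.
- by rewrite rmorphM rpredM.
- by rewrite fmorphV rpredV.
Qed.

(** If n(y) = s(y) and n'(y) = s'(y), then [n] followed by [n'] maps [y] to
    n'(s(y)) = s(n'(y)) = s(s'(y)). *)
Lemma isog_gal_orbit (F k : fieldType) (Omega : splittingFieldType k)
    (i : {rmorphism ratfun F -> Omega}) (Fx : {subfield Omega})
    (G : {fset PGL2 F}) (y : Omega) (N := 'Gal(<<Fx; y>> / Fx)%g) :
    i (indet F) = y -> (forall c, i (cst c) \in Fx) ->
    (forall n, n \in N -> exists2 s, s \in G & n y = i (lft s)) ->
    (forall s, s \in G -> exists2 n, n \in N & n y = i (lft s)) ->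
  isog_fset N G.
Proof.
move=> iX Fx_cst gal_lft lft_gal.
have My : y \in <<Fx; y>>%AS := memv_adjoin Fx y.
have gal_subst n s : n \in N -> n y = i (lft s) ->
    forall t, n (i (lft t)) = i (lft (t * s)%g).
  move=> Nn ny t; have [e [ec eX]] := subst_endo s.
  rewrite -(lft_subst t ec eX).
  apply: (rmorph_ratfun_eq (h1 := n \o i) (h2 := i \o e)) => [c|] /=.
    by rewrite ec (fixed_gal (subv_adjoin Fx y) Nn).
  by rewrite iX eX.
have /fin_all_exists[phi phiP] n : exists s, n \in N ->
    s \in G /\ n y = i (lft s).
  have [/gal_lft[s Gs Ds] | _] := boolP (n \in N); last by exists 1%g.
  by exists s.
exists phi; split=> [u v Nu Nv | u v Nu Nv Duv | s].
- apply/lft_inj/(fmorph_inj i); have [_ <-] := phiP _ (groupM Nu Nv).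
  have [_ uy] := phiP u Nu; have [_ vy] := phiP v Nv.
  by rewrite galM // uy (gal_subst v (phi v)).
- apply/eqP; rewrite (gal_adjoin_eq Nu Nv).
  by have [_ ->] := phiP u Nu; have [_ ->] := phiP v Nv; rewrite Duv.
split=> [/lft_gal[n Nn ny] | [n Nn ->]]; last by have [] := phiP n Nn.
exists n => //; apply/lft_inj/(fmorph_inj i); rewrite -ny.
by have [] := phiP n Nn.
Qed.

Theorem lemma36 (F : fieldType) (G : {fset PGL2 F})
    (Ggroup : group_closed (mem G))
    (Gfull : forall K : {pred F}, divring_closed K ->
       (exists a : F, a \notin K) -> ~ defined_over K G)
    (f g : {poly F}) (co_fg : coprimep f g)
    (monic_fg : (f \is monic) || (g \is monic))
    (coef_fg : exists i : nat, (orbit_poly G)`_i = f%:F / g%:F)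
    (nonconst_fg : forall c : F, f%:F / g%:F <> c%:P%:F)
    (hT : finGroupType) (H : hT -> {rmorphism F -> F})
    (Haut : faithful_aut H) (Hnontrivial : (1 < #|hT|)%N)
    (HfixG : forall u : hT, [fset PGL2_map (H u) s | s in G]%fset = G)
    (* Omega is an extension of E(x), where E = fixed_field H, in which F(x)
       embeds, via j, compatibly with the inclusion of E(x) in F(x). *)
    (Omega : splittingFieldType (ratfun (fixed_field H)))
    (j : {rmorphism ratfun F -> Omega})
    (jE : forall p : {poly fixed_field H},
       j (map_poly val p)%:F = in_alg Omega p%:F)
    (Fx : {subfield Omega})
    (FxP : forall z : Omega, z \in Fx <-> exists q, z = j q)
    (L : {subfield Omega})
    (Lsplit : splittingFieldFor 1%AS (map_poly j (fiber_poly f g)) L) :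
  [/\ f \is a polyOver (fixed H) /\ g \is a polyOver (fixed H),
      splittingFieldFor Fx (map_poly j (fiber_poly f g)) L,
      ('Gal(L / Fx) <| 'Gal(L / 1%AS))%g,
      isog_fset 'Gal(L / Fx)%g G
    & [splits 'Gal(L / 1%AS), over 'Gal(L / Fx)]%g].
Proof.
have nonconst : forall c, f%:F / g%:F <> cst c := nonconst_fg.
have [k Dfg] := coef_fg.
have [f0 g0] := (fiber_num_neq0 nonconst, fiber_den_neq0 nonconst).
have fix_fg (e : {rmorphism ratfun F -> ratfun F}) m :
    {in G, forall s, m s \in G} -> {in G, forall s, e (lft s) = lft (m s)} ->
  e (f%:F / g%:F) = f%:F / g%:F.
  by move=> mG em; rewrite -Dfg -coef_map (map_orbit_poly mG em).
have subst_fg s : s \in G -> exists e : {rmorphism ratfun F -> ratfun F},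
    [/\ forall c, e (cst c) = cst c, e (indet F) = lft s
      & e (f%:F / g%:F) = f%:F / g%:F].
  move=> Gs; have [e [ec eX]] := subst_endo s; exists e; split=> //.
  apply: (fix_fg e (fun t => t * s)%g) => t Gt; last exact: lft_subst.
  by have := group_closedM Ggroup; apply.
have /fin_all_exists[tau tauP] u := coef_endo (H u).
have tauc u := (tauP u).1; have tauX u := (tauP u).2.
have tau_fg u : tau u (f%:F / g%:F) = f%:F / g%:F.
  apply: (fix_fg (tau u) (PGL2_map (H u))) => s Gs; last exact: lft_map.
  by rewrite -[X in _ \in X](HfixG u) in_imfset.
have fg_fixed : f \is a polyOver (fixed H) /\ g \is a polyOver (fixed H).
  have fixed_u u : map_poly (H u) f = f /\ map_poly (H u) g = g.
    apply: map_poly_frac_fixed => //; apply/eqP; rewrite -tofrac_eq !tofracM.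
    rewrite -!(coef_endo_poly _ (tauc u) (tauX u)).
    by rewrite -eqr_div ?fmorph_eq0 ?tofrac_eq0 // -fmorph_div tau_fg.
  by split; apply/polyOver_fixedP => u; have [] := fixed_u u.
set p := map_poly j _ in Lsplit *.
have [rs Dp defL] := Lsplit.
have [y rs_y] : exists y, y \in rs.
  have := fiber_size_gt1 j nonconst; rewrite -/p (eqp_size Dp) size_prod_XsubC.
  by case: (rs) => // y rs1 _; exists y; rewrite mem_head.
have p_y : root p y by rewrite (eqp_root Dp) root_prod_XsubC.
have [i [ic iX ifg]] := fiber_root_embedding co_fg nonconst p_y.
have Dp_G := fiber_poly_factor co_fg nonconst Dfg ic ifg subst_fg.
rewrite -/p in Dp_G.
have rs_G : rs =i [seq i (lft s) | s <- G].
  by move=> z; rewrite -!root_prod_XsubC -(eqp_root Dp) (eqp_root Dp_G).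
have embed := @fiber_embed _ _ _ _ _ _ ic ifg.
have Fxj z : z \in Fx -> exists q, z = j q by move/FxP.
have jFx q : j q \in Fx by apply/FxP; exists q.
have p_Fx : p \is a polyOver Fx by apply/polyOverP=> m; rewrite coef_map jFx.
have i_cst c : i (cst c) \in Fx by rewrite ic.
have M_image : forall z, z \in <<Fx; y>>%AS <-> exists q, z = i q.
  rewrite -iX; apply: Fadjoin_image FxP _ i_cst => q.
  have [r [-> _]] :=
    embed id idfun idfun (fun=> erefl) erefl (fun=> erefl) erefl q.
  by exists r.
pose M := <<Fx; y>>%AS.
have sFxM : (Fx <= M)%VS := subv_adjoin Fx y.
have Miq q : i q \in M by apply/M_image; exists q.
have splitM : splittingFieldFor Fx p M.
  exists [seq i (lft s) | s <- G] => //; apply/eqP; rewrite eqEsubv.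
  apply/andP; split; first by apply/Fadjoin_seqP; split=> // _ /mapP[s _ ->].
  apply/FadjoinP; split; first exact: subv_adjoin_seq.
  by apply: seqv_sub_adjoin; rewrite -rs_G.
have galM_Fx : galois Fx M.
  apply/splitting_galoisField; exists p; split=> //.
  rewrite (eqp_separable Dp_G) separable_prod_XsubC map_inj_uniq ?fset_uniq //.
  by move=> s t /fmorph_inj/lft_inj.
(* An element of E(x) is in the image of j, where e acts as t does, and t fixes
   the elements of F(x) that come from E(x). *)
have e_base (sigma : F -> F) (t e : {rmorphism ratfun F -> ratfun F}) :
    (forall c, t (cst c) = cst (sigma c)) -> t (indet F) = indet F ->
    (forall c, e (cst c) = cst (sigma c)) -> e (f%:F / g%:F) = f%:F / g%:F ->
    (forall q, (forall u, tau u q = q) -> t q = q) ->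
  forall c q, i q = c%:A -> e q = q.
  move=> tc tX ec efg t_fix c q Dq.
  have [r [Dr tau_r]] := base_coef_fixed tauc tauX jE c.
  have [q' [Dq' Eq']] := embed _ _ _ tc tX ec efg r.
  have -> : q = q' by apply: (fmorph_inj i); rewrite Dq Dr.
  by apply: (fmorph_inj i); rewrite -Eq' -Dq' t_fix.
have isoN : isog_fset 'Gal(M / Fx)%g G.
  apply: (isog_gal_orbit iX) => // [n Nn|s Gs].
    have: root (map_poly n p) (n y) by rewrite rmorph_root.
    rewrite (fixedPoly_gal sFxM Nn) // (eqp_root Dp_G) root_prod_XsubC.
    by move/mapP.
  have [e [ec eX efg]] := subst_fg s Gs.
  have base := e_base id idfun e (fun=> erefl) erefl ec efg (fun _ _ => erefl).
  have [n _ Dn] := gal_transport M_image base.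
  exists n; last by rewrite -[X in n X]iX Dn eX.
  rewrite gal_kHom //; apply/kAHomP=> z /Fxj[q ->].
  have [r [-> ir]] := embed id idfun e (fun=> erefl) erefl ec efg q.
  by rewrite Dn -ir.
have /fin_all_exists[kappa kappaP] u : exists x : gal_of M,
    forall q, x (i q) = i (tau u q).
  have base := e_base _ _ _
    (tauc u) (tauX u) (tauc u) (tau_fg u) (fun q => @^~ u).
  by have [x _ Dx] := gal_transport M_image base; exists x.
have kappa_j u q : kappa u (j q) = j (tau u q).
  have [r [-> ->]] := embed _ _ _ (tauc u) (tauX u) (tauc u) (tau_fg u) q.
  by rewrite kappaP.
have kappa_y u : kappa u y = y.
  by rewrite -[X in kappa u X]iX kappaP tauX iX.
have gal_ext (x z : gal_of M) : (forall q, x (i q) = z (i q)) -> x = z.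
  by move=> xz; apply/eqP/gal_eqP => _ /M_image[q ->].
have kappa1 : kappa 1%g = 1%g.
  apply: gal_ext => q; rewrite gal_id kappaP; congr (i _).
  apply: (rmorph_ratfun_eq (h2 := idfun)) q => [c|] //=.
  by rewrite tauc (faithful_aut1 Haut).
(* Automorphisms of M are composed from left to right, those of F from right to
   left, so kappa reverses products; its image is a group all the same. *)
have kappaM u v : (kappa u * kappa v)%g = kappa (v * u)%g.
  apply: gal_ext => q; rewrite galM // !kappaP; congr (i _).
  apply: (rmorph_ratfun_eq (h1 := tau v \o tau u)) q => [c|] /=.
    by rewrite !tauc Haut.1.
  by rewrite !tauX.
have kappa_group : group_set [set kappa u | u in [set: hT]].
  apply/group_setP; split; first by rewrite -kappa1 imset_f ?inE.
  by move=> _ _ /imsetP[u _ ->] /imsetP[v _ ->]; rewrite kappaM imset_f ?inE.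
pose K : {group gal_of M} := group kappa_group.
have KP x : x \in K -> exists u, x = kappa u by case/imsetP=> u _ ->; exists u.
have K_y x : x \in K -> x y = y by case/KP=> u ->.
have K_Fx x : x \in K -> {in Fx, forall z, x z \in Fx}.
  by case/KP=> u -> _ /Fxj[q ->]; rewrite kappa_j.
have K_fixed : {in Fx, forall z, (forall x, x \in K -> x z = z) -> z \in 1%AS}.
  move=> _ /Fxj[q ->] fix_q.
  have [u|c ->] := coef_fixed_base Haut tauc tauX jE (q := q); last first.
    by rewrite rpredZ ?rpred1.
  by apply: (fmorph_inj j); rewrite -kappa_j fix_q // imset_f ?inE.
have complK := Fadjoin_complement galM_Fx K_y K_Fx K_fixed.
have nKN := Fadjoin_normaliser K_Fx; rewrite -/M in complK nKN.
have /complP[_ defNK] := complK.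
have L_root z : z \in rs -> z \in L.
  by move=> rs_z; rewrite -defL; apply: seqv_sub_adjoin.
have LM : L = M.
  have sLM : (L <= M)%VS.
    rewrite -defL; apply/Fadjoin_seqP; split=> [|z]; first exact: sub1v.
    by rewrite rs_G => /mapP[s _ ->].
  apply: galois_trivial_gal.
    apply: (@galoisS _ _ 1%AS); first by rewrite sub1v.
    exact: Fadjoin_galois galM_Fx K_fixed.
  apply/trivgP/subsetP=> x Lx.
  have fix_x z : z \in rs -> x z = z by move/L_root; apply: fixed_gal.
  have: x \in ('Gal(M / Fx) * K)%g.
    by rewrite defNK (subsetP (galS M (sub1v L))).
  case/mulsgP=> n _ Nn /KP[u ->] Dx.
  have n1 : n = 1%g.
    apply/eqP; rewrite (gal_adjoin_eq Nn (group1 _)) gal_id.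
    have Dxy : x y = kappa u (n y) by rewrite Dx galM ?memv_adjoin.
    apply/eqP/(fmorph_inj (kappa u))/(etrans (esym Dxy)).
    by rewrite [RHS]kappa_y fix_x.
  rewrite {}Dx {}n1 mul1g in fix_x *.
  suff -> : u = 1%g by rewrite kappa1 inE.
  apply: (PGL2_map_faithful Haut Gfull) => s Gs.
  apply/lft_inj/(fmorph_inj i); rewrite -(lft_map _ (tauc u) (tauX u)) -kappaP.
  by apply: fix_x; rewrite rs_G; apply/mapP; exists s.
rewrite {}LM; split=> //; last by apply/splitsP; exists K.
by rewrite /normal galS ?sub1v //= -defNK mulG_subG normG.
Qed.
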